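(* There exist an open balanced set $U\subset c_0$ and a function $g\in H_b(U)$ whose holomorphic extension to $\widehat U_{\mathcal P(c_0)}$ is not of bounded type.
   Context: $c_0$ is the complex Banach space of null sequences and $\mathcal P(c_0)$ the space of all continuous polynomials $c_0\to\mathbb C$. For an open $W\subset c_0$, a set $A\subset W$ is $W$-bounded if it is bounded and has positive distance to $c_0\setminus W$. A holomorphic function on $W$ is of bounded type if it is bounded on every $W$-bounded set; $H_b(W)$ is the algebra of such functions. For a $U$-bounded set $A$, $\widehat A_{\mathcal P(c_0)}=\{x\in c_0:|P(x)|\le\sup_A|P|\ \forall P\in\mathcal P(c_0)\}$. The hull of the open set $U$ is $\widehat U_{\mathcal P(c_0)}=\bigcup_n\widehat{(U_n)}_{\mathcal P(c_0)}$, where $(U_n)_n$ is a fundamental sequence of $U$-bounded sets, e.g. $U_n=\{x\in U:\mathrm{dist}(x,c_0\setminus U)\ge 1/n,\ \|x\|\le n\}$. For $U$ open and balanced, $\widehat U_{\mathcal P(c_0)}$ is an open connected set containing $U$, and every $f\in H_b(U)$ extends uniquely to a holomorphic function on $\widehat U_{\mathcal P(c_0)}$. *)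

(* Defs.v *)
From Stdlib Require Import Reals Lra Lia ProofIrrelevance FunctionalExtensionality.
From mathcomp Require Import ssreflect ssrbool eqtype fintype.
From Coquelicot Require Import Coquelicot.

Open Scope R_scope.

(** * The complex Banach space [c0] of null sequences *)

Record c0 : Type := mk_c0 {
  coord :> nat -> C;
  coord_null : is_lim_seq (fun n => Cmod (coord n)) 0 }.

Lemma c0_ext (x y : c0) : (forall n, x n = y n) -> x = y.
Proof.
  destruct x as [x hx], y as [y hy]; simpl; intros H.
  assert (E : x = y) by (apply functional_extensionality; exact H).
  subst y; f_equal; apply proof_irrelevance.
Qed.

Lemma null_le (u v : nat -> R) :
  (forall n, 0 <= u n <= v n) -> is_lim_seq v 0 -> is_lim_seq u 0.
Proof.
  intros H Hv.
  apply (is_lim_seq_le_le (fun _ => 0) u v); auto.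
  apply is_lim_seq_const.
Qed.

Definition c0_zero : c0.
Proof.
  exists (fun _ => RtoC 0).
  apply (is_lim_seq_ext (fun _ => 0)); [intros _; now rewrite Cmod_0|].
  apply is_lim_seq_const.
Defined.

Definition c0_plus (x y : c0) : c0.
Proof.
  exists (fun n => Cplus (x n) (y n)).
  apply (null_le _ (fun n => Cmod (x n) + Cmod (y n))).
  - intros n; split; [apply Cmod_ge_0 | apply Cmod_triangle].
  - replace (Finite 0) with (Finite (0 + 0)) by (f_equal; ring).
    apply is_lim_seq_plus'; apply coord_null.
Defined.

Definition c0_scal (a : C) (x : c0) : c0.
Proof.
  exists (fun n => Cmult a (x n)).
  apply (is_lim_seq_ext (fun n => Cmod a * Cmod (x n))).
  - intros n; now rewrite Cmod_mult.
  - replace (Finite 0) with (Rbar_mult (Cmod a) 0)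
      by (simpl; f_equal; ring).
    apply is_lim_seq_scal_l, coord_null.
Defined.

Definition c0_opp (x : c0) : c0.
Proof.
  exists (fun n => Copp (x n)).
  apply (is_lim_seq_ext (fun n => Cmod (x n))).
  - intros n; now rewrite Cmod_opp.
  - apply coord_null.
Defined.

Definition c0_norm (x : c0) : R := real (Sup_seq (fun n => Finite (Cmod (x n)))).

Lemma c0_bounded (x : c0) : exists M, forall n, Cmod (x n) <= M.
Proof.
  destruct (filterlim_bounded (K := R_AbsRing) (V := R_NormedModule)
              (fun n => Cmod (x n))) as [M HM].
  - exists 0; exact (coord_null x).
  - exists M; intros n; eapply Rle_trans; [|exact (HM n)].
    unfold norm; simpl; unfold abs; simpl; apply Rle_abs.
Qed.

Lemma c0_norm_is_sup (x : c0) :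
  is_sup_seq (fun n => Finite (Cmod (x n))) (Finite (c0_norm x)).
Proof.
  unfold c0_norm.
  assert (H := Sup_seq_correct (fun n => Finite (Cmod (x n)))).
  destruct (c0_bounded x) as [M HM].
  destruct (Sup_seq (fun n => Finite (Cmod (x n)))) as [r| |]; simpl in *; auto.
  - destruct (H M) as [n Hn]; specialize (HM n); lra.
  - specialize (H 0 0%nat); assert (h := Cmod_ge_0 (x 0%nat)); lra.
Qed.

Lemma c0_norm_ub (x : c0) n : Cmod (x n) <= c0_norm x.
Proof.
  apply Rnot_lt_le; intros Hlt.
  assert (He : 0 < Cmod (x n) - c0_norm x) by lra.
  destruct (c0_norm_is_sup x (mkposreal _ He)) as [H _].
  specialize (H n); simpl in H; lra.
Qed.

Lemma c0_norm_lub (x : c0) M : (forall n, Cmod (x n) <= M) -> c0_norm x <= M.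
Proof.
  intros HM; apply Rnot_lt_le; intros Hlt.
  assert (He : 0 < c0_norm x - M) by lra.
  destruct (c0_norm_is_sup x (mkposreal _ He)) as [_ [n H]].
  specialize (HM n); simpl in H; lra.
Qed.

Lemma c0_norm_ge_0 (x : c0) : 0 <= c0_norm x.
Proof.
  eapply Rle_trans; [apply (Cmod_ge_0 (x 0%nat)) | apply c0_norm_ub].
Qed.

Lemma c0_norm_triangle (x y : c0) :
  c0_norm (c0_plus x y) <= c0_norm x + c0_norm y.
Proof.
  apply c0_norm_lub; intros n; simpl.
  eapply Rle_trans; [apply Cmod_triangle|].
  apply Rplus_le_compat; apply c0_norm_ub.
Qed.

Lemma c0_norm_scal (a : C) (x : c0) :
  c0_norm (c0_scal a x) <= Cmod a * c0_norm x.
Proof.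
  apply c0_norm_lub; intros n; simpl; rewrite Cmod_mult.
  apply Rmult_le_compat_l; [apply Cmod_ge_0 | apply c0_norm_ub].
Qed.

Lemma c0_norm_zero : c0_norm c0_zero = 0.
Proof.
  apply Rle_antisym; [|apply c0_norm_ge_0].
  apply c0_norm_lub; intros n; simpl; rewrite Cmod_0; lra.
Qed.

Lemma c0_norm_eq_0 (x : c0) : c0_norm x = 0 -> x = c0_zero.
Proof.
  intros H; apply c0_ext; intros n; simpl.
  apply Cmod_eq_0, Rle_antisym; [|apply Cmod_ge_0].
  rewrite <- H; apply c0_norm_ub.
Qed.

Lemma c0_plus_comm x y : c0_plus x y = c0_plus y x.
Proof. apply c0_ext; intros n; simpl; apply Cplus_comm. Qed.

Lemma c0_plus_assoc x y z : c0_plus x (c0_plus y z) = c0_plus (c0_plus x y) z.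
Proof. apply c0_ext; intros n; simpl; apply Cplus_assoc. Qed.

Lemma c0_plus_zero_r x : c0_plus x c0_zero = x.
Proof. apply c0_ext; intros n; simpl; apply Cplus_0_r. Qed.

Lemma c0_plus_opp_r x : c0_plus x (c0_opp x) = c0_zero.
Proof. apply c0_ext; intros n; simpl; apply Cplus_opp_r. Qed.

Definition c0_AbelianMonoid_mixin :=
  AbelianMonoid.Mixin c0 c0_plus c0_zero
    c0_plus_comm c0_plus_assoc c0_plus_zero_r.

Canonical c0_AbelianMonoid := AbelianMonoid.Pack c0 c0_AbelianMonoid_mixin c0.

Definition c0_AbelianGroup_mixin :=
  AbelianGroup.Mixin c0_AbelianMonoid c0_opp c0_plus_opp_r.

Canonical c0_AbelianGroup :=
  AbelianGroup.Pack c0 (AbelianGroup.Class _ _ c0_AbelianGroup_mixin) c0.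

Lemma c0_scal_assoc (a b : C) x :
  c0_scal a (c0_scal b x) = c0_scal (Cmult a b) x.
Proof. apply c0_ext; intros n; simpl; apply Cmult_assoc. Qed.

Lemma c0_scal_one x : c0_scal (RtoC 1) x = x.
Proof. apply c0_ext; intros n; simpl; apply Cmult_1_l. Qed.

Lemma c0_scal_distr_l (a : C) x y :
  c0_scal a (c0_plus x y) = c0_plus (c0_scal a x) (c0_scal a y).
Proof. apply c0_ext; intros n; simpl; ring. Qed.

Lemma c0_scal_distr_r (a b : C) x :
  c0_scal (Cplus a b) x = c0_plus (c0_scal a x) (c0_scal b x).
Proof. apply c0_ext; intros n; simpl; ring. Qed.

Definition c0_ModuleSpace_mixin :=
  ModuleSpace.Mixin C_AbsRing c0_AbelianGroup c0_scal
    c0_scal_assoc c0_scal_one c0_scal_distr_l c0_scal_distr_r.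

Canonical c0_ModuleSpace :=
  ModuleSpace.Pack C_AbsRing c0
    (ModuleSpace.Class _ _ _ c0_ModuleSpace_mixin) c0.

Definition c0_ball (x : c0) (e : R) (y : c0) : Prop :=
  c0_norm (c0_plus y (c0_opp x)) < e.

Lemma c0_ball_center (x : c0) (e : posreal) : c0_ball x e x.
Proof.
  unfold c0_ball; rewrite c0_plus_opp_r c0_norm_zero; apply cond_pos.
Qed.

Lemma c0_ball_sym (x y : c0) (e : R) : c0_ball x e y -> c0_ball y e x.
Proof.
  unfold c0_ball; intros H; eapply Rle_lt_trans; [|exact H].
  apply c0_norm_lub; intros n; simpl.
  replace (Cplus (x n) (Copp (y n))) with (Copp (Cplus (y n) (Copp (x n))))
    by ring.
  rewrite Cmod_opp; apply (c0_norm_ub (c0_plus y (c0_opp x)) n).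
Qed.

Lemma c0_ball_triangle (x y z : c0) (e1 e2 : R) :
  c0_ball x e1 y -> c0_ball y e2 z -> c0_ball x (e1 + e2) z.
Proof.
  unfold c0_ball; intros H1 H2.
  replace (c0_plus z (c0_opp x))
    with (c0_plus (c0_plus y (c0_opp x)) (c0_plus z (c0_opp y)))
    by (apply c0_ext; intros n; simpl; ring).
  eapply Rle_lt_trans; [apply c0_norm_triangle | lra].
Qed.

Definition c0_UniformSpace_mixin :=
  UniformSpace.Mixin c0 c0_zero c0_ball c0_ball_center c0_ball_sym c0_ball_triangle.

Canonical c0_UniformSpace := UniformSpace.Pack c0 c0_UniformSpace_mixin c0.

Canonical c0_NormedModuleAux :=
  NormedModuleAux.Pack C_AbsRing c0
    (NormedModuleAux.Class C_AbsRing c0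
       (ModuleSpace.class _ c0_ModuleSpace) c0_UniformSpace_mixin) c0.

Lemma c0_norm_ball_1 (x y : c0) (e : R) :
  c0_norm (minus y x) < e -> c0_ball x e y.
Proof. intros H; exact H. Qed.

Lemma c0_norm_ball_2 (x y : c0) (e : posreal) :
  c0_ball x e y -> c0_norm (minus y x) < 1 * e.
Proof. intros H; rewrite Rmult_1_l; exact H. Qed.

Definition c0_NormedModule_mixin :=
  NormedModule.Mixin C_AbsRing c0_NormedModuleAux c0_norm 1
    c0_norm_triangle c0_norm_scal c0_norm_ball_1 c0_norm_ball_2 c0_norm_eq_0.

Canonical c0_NormedModule :=
  NormedModule.Pack C_AbsRing c0
    (NormedModule.Class _ _ _ c0_NormedModule_mixin) c0.

(** * Continuous polynomials on [c0] *)

Definition update {k : nat} (x : 'I_k -> c0) (i : 'I_k) (u : c0) : 'I_k -> c0 :=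
  fun j => if j == i then u else x j.

Definition multilinear {k : nat} (A : ('I_k -> c0) -> C) : Prop :=
  forall (x : 'I_k -> c0) (i : 'I_k) (a : C) (u v : c0),
    A (update x i (plus (scal a u) v))
    = Cplus (Cmult a (A (update x i u))) (A (update x i v)).

Definition homogeneous_polynomial (k : nat) (P : c0 -> C) : Prop :=
  exists A : ('I_k -> c0) -> C, multilinear A /\ forall x, P x = A (fun _ => x).

Definition polynomial (P : c0 -> C) : Prop :=
  exists (n : nat) (Q : nat -> c0 -> C),
    (forall k, homogeneous_polynomial k (Q k)) /\
    forall x, P x = sum_n (fun k => Q k x) n.

Definition continuous_polynomial (P : c0 -> C) : Prop :=
  polynomial P /\ forall x, continuous P x.

(** * Bounded sets and functions of bounded type *)

(* The infimum is taken in [Rbar], so the distance to the empty set is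
   [p_infty]. *)
Definition set_dist (A B : c0 -> Prop) : Rbar :=
  Glb_Rbar (fun r => exists a b, A a /\ B b /\ r = norm (minus a b)).

Definition dist (x : c0) (B : c0 -> Prop) : Rbar := set_dist (fun a => a = x) B.

Definition compl (W : c0 -> Prop) : c0 -> Prop := fun x => ~ W x.

Definition bounded_in (W A : c0 -> Prop) : Prop :=
  (forall x, A x -> W x) /\
  (exists M, forall x, A x -> norm x <= M) /\
  Rbar_lt 0 (set_dist A (compl W)).

(* A function on an open set [W] is represented by a total function on [c0],
   of which only the values on [W] matter.  [ex_filterdiff] over [C_AbsRing] is
   complex Frechet differentiability, with a bounded C-linear differential. *)
Definition holomorphic_on (W : c0 -> Prop) (f : c0 -> C) : Prop :=
  forall x, W x ->
    ex_filterdiff (K := C_AbsRing) (U := c0_NormedModule) (V := C_NormedModule)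
      f (locally x).

Definition bounded_type (W : c0 -> Prop) (f : c0 -> C) : Prop :=
  forall A, bounded_in W A -> exists M, forall x, A x -> Cmod (f x) <= M.

Definition Hb (W : c0 -> Prop) (f : c0 -> C) : Prop :=
  holomorphic_on W f /\ bounded_type W f.

(** * Polynomial hulls *)

Definition sup_on (A : c0 -> Prop) (P : c0 -> C) : Rbar :=
  Lub_Rbar (fun r => exists a, A a /\ r = Cmod (P a)).

Definition poly_hull (A : c0 -> Prop) : c0 -> Prop :=
  fun x => forall P, continuous_polynomial P -> Rbar_le (Cmod (P x)) (sup_on A P).

(* The fundamental sequence is indexed from 0: [exhaustion U n] is [U_(n+1)]. *)
Definition exhaustion (U : c0 -> Prop) (n : nat) : c0 -> Prop :=
  fun x => U x /\ Rbar_le (/ INR (S n)) (dist x (compl U)) /\ norm x <= INR (S n).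

Definition open_hull (U : c0 -> Prop) : c0 -> Prop :=
  fun x => exists n, poly_hull (exhaustion U n) x.

Definition balanced (U : c0 -> Prop) : Prop :=
  forall (a : C) x, Cmod a <= 1 -> U x -> U (scal a x).

(* Main.v *)
Require Import Defs.
From Stdlib Require Import Reals Lra Lia FunctionalExtensionality.
From mathcomp Require Import ssreflect ssrbool eqtype fintype.
From Coquelicot Require Import Coquelicot.

(** Group the coordinates of [x] in pairs [(z_n, w_n) = (x (2n), x (2n+1))].  The
    domain asks that, for every [n], either [|z_n| < 1] or
    [||z_n| - |w_n|| < 1/(n+1)], with a margin independent of [n].  The part of
    it where [|z_n| >= 1] is a shell around [|z_n| = |w_n|] which gets thinner as
    [n] grows, while the function is the entire function [sum z_n^(n+1)], so that
    holomorphy of the extension costs nothing.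

    A bounded set at distance at least [e] from the complement of the domain cannot enter
    the shells with [n+1 > 8/e], hence satisfies [|z_n| <= 1 - e/2] for all large
    [n] ([even_part_small]).  The function is therefore dominated by a geometric
    series on it ([diagonal_series_bounded_type]).

    The polynomial hull ignores how thin the shells are.  If [x] is within
    distance [1/2] of [2 e_(2n)] and [c = w_n / z_n], the affine disc whose [n]-th
    pair is [(z_n (1 + conj c t), z_n (t + c))], the other coordinates being those
    of [x], passes through [x] at [t = 0]; its boundary [|t| = 1] lies in the
    shell because [|1 + conj c t| = |t + c|] there.  By the maximum principle for
    polynomials in [t], the point [x] is in the hull ([ball_spike_in_hull]).  So
    the points [2 e_(2n)] stay at distance at least [1/2] from the complement of
    the hull, and the function takes there the values [2^(n+1)]
    ([diagonal_series_unbounded_on_spikes]). *)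

(** * Averages over roots of unity *)

(* [ring] does not see through the carriers of the algebraic structures on [C]. *)
Ltac Cring :=
  change plus with Cplus;
  lazymatch goal with |- ?a = ?b => change (@eq C a b) end; ring.

Definition cis (t : R) : C := (cos t, sin t).

Lemma Cmod_cis t : Cmod (cis t) = 1.
Proof.
  unfold Cmod, cis; simpl.
  replace (cos t * (cos t * 1) + sin t * (sin t * 1)) with 1.
  - apply sqrt_1.
  - generalize (sin2_cos2 t); unfold Rsqr; lra.
Qed.

Lemma cis_pow t n : Cpow (cis t) n = cis (INR n * t).
Proof.
  induction n as [|n IH].
  - unfold cis; simpl; rewrite Rmult_0_l cos_0 sin_0; reflexivity.
  - rewrite Cpow_S IH S_INR.
    replace ((INR n + 1) * t) with (t + INR n * t) by ring.
    unfold cis, Cmult; simpl; rewrite cos_plus sin_plus; f_equal; ring.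
Qed.

Lemma cis_neq_1 t : 0 < t < 2 * PI -> cis t <> RtoC 1.
Proof.
  intros Ht E; apply (f_equal fst) in E; simpl in E.
  assert (H : 0 < sin (t / 2)) by (apply sin_gt_0; lra).
  replace t with (2 * (t / 2)) in E by field.
  rewrite cos_2a_sin in E.
  assert (0 < sin (t / 2) * sin (t / 2)) by (apply Rmult_lt_0_compat; lra).
  lra.
Qed.

Lemma geometric_sum (q : C) n :
  Cmult (Cminus q 1) (sum_n (fun j => Cpow q j) n) = Cminus (Cpow q (S n)) 1.
Proof.
  induction n as [|n IH].
  - rewrite sum_O; simpl; ring.
  - rewrite sum_Sn; change plus with Cplus.
    rewrite Cmult_plus_distr_l IH (Cpow_S q (S n)); ring.
Qed.

Definition root_of_unity (d j : nat) : C := cis (INR j * (2 * PI / INR (S d))).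

Lemma sum_roots_of_unity d m : (m <= d)%nat ->
  sum_n (fun j => Cpow (root_of_unity d j) m) d
  = Cmult (INR (S d)) (Cpow 0 m).
Proof.
  intros Hm.
  assert (HN := lt_0_INR (S d) (Nat.lt_0_succ d)).
  destruct m as [|m].
  - rewrite (sum_n_ext _ (fun _ => RtoC 1)); [|intros j; reflexivity].
    clear Hm HN; induction d as [|d IH].
    + rewrite sum_O; simpl; ring.
    + rewrite sum_Sn IH (S_INR (S d)); change plus with Cplus.
      rewrite RtoC_plus; simpl; ring.
  - set (q := cis (INR (S m) * (2 * PI / INR (S d)))).
    assert (Hq : q <> RtoC 1).
    { apply cis_neq_1.
      assert (HS := lt_0_INR (S m) (Nat.lt_0_succ m)).
      assert (Hlt : INR (S m) < INR (S d)) by (apply lt_INR; lia).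
      assert (HP := PI_RGT_0).
      replace (INR (S m) * (2 * PI / INR (S d)))
        with ((2 * PI) * (INR (S m) / INR (S d))) by (field; lra).
      assert (0 < INR (S m) / INR (S d)) by (apply Rdiv_lt_0_compat; lra).
      assert (INR (S m) / INR (S d) < 1) by (apply Rlt_div_l; lra).
      split; [apply Rmult_lt_0_compat; lra|].
      rewrite <- (Rmult_1_r (2 * PI)) at 2; apply Rmult_lt_compat_l; lra. }
    rewrite (sum_n_ext _ (fun j => Cpow q j)).
    2:{ intros j; unfold root_of_unity, q; rewrite !cis_pow; f_equal; ring. }
    assert (E := geometric_sum q d).
    replace (Cpow q (S d)) with (RtoC 1) in E.
    2:{ unfold q; rewrite cis_pow.
        replace (INR (S d) * (INR (S m) * (2 * PI / INR (S d))))
          with (0 + 2 * INR (S m) * PI) by (field; lra).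
        unfold cis; rewrite cos_period sin_period cos_0 sin_0; reflexivity. }
    set (s := sum_n _ _) in *.
    replace s with (Cdiv (Cmult (Cminus q 1) s) (Cminus q 1)).
    + rewrite E; simpl; field; intros H0; apply Hq.
      replace q with (Cplus (Cminus q 1) 1) by ring; rewrite H0; ring.
    + field; intros H0; apply Hq.
      replace q with (Cplus (Cminus q 1) 1) by ring; rewrite H0; ring.
Qed.

(** Polynomial functions of degree at most [n], in Horner form: this spares the
    coefficients, and the induction for [mean_value] follows the recursion. *)
Fixpoint poly_deg (n : nat) (f : C -> C) : Prop :=
  match n with
  | O => forall t, f t = f 0
  | S n => exists g h, poly_deg n g /\ poly_deg n h /\
             forall t, f t = Cplus (g t) (Cmult t (h t))
  end.

Lemma poly_deg_const n c : poly_deg n (fun _ => c).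
Proof.
  revert c; induction n as [|n IH]; intros c; simpl; [reflexivity|].
  exists (fun _ => c), (fun _ => RtoC 0).
  repeat split; try apply IH; intros t; ring.
Qed.

Lemma poly_deg_S n f : poly_deg n f -> poly_deg (S n) f.
Proof.
  intros H; exists f, (fun _ => RtoC 0).
  split; [exact H|split; [apply poly_deg_const|intros t; ring]].
Qed.

Lemma poly_deg_plus n f g :
  poly_deg n f -> poly_deg n g -> poly_deg n (fun t => Cplus (f t) (g t)).
Proof.
  revert f g; induction n as [|n IH]; intros f g; simpl.
  - intros Hf Hg t; rewrite (Hf t) (Hg t); reflexivity.
  - intros (f1 & f2 & H1 & H2 & Hf) (g1 & g2 & H3 & H4 & Hg).
    exists (fun t => Cplus (f1 t) (g1 t)), (fun t => Cplus (f2 t) (g2 t)).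
    repeat split; auto; intros t; rewrite Hf Hg; ring.
Qed.

(** The factor [t^m] makes the induction on the degree go through: the Horner
    step turns it into [t^(m+1)].  The average only sees the monomial [t^0], as
    long as the total degree stays below the number [d + 1] of roots. *)
Lemma mean_value d m n f : (m + n <= d)%nat -> poly_deg n f ->
  sum_n (fun j => Cmult (Cpow (root_of_unity d j) m) (f (root_of_unity d j))) d
  = Cmult (INR (S d)) (Cmult (Cpow 0 m) (f 0)).
Proof.
  revert m f; induction n as [|n IH]; intros m f Hd Hf; simpl in Hf.
  - rewrite (sum_n_ext _
      (fun j => mult (Cpow (root_of_unity d j) m) (f 0))).
    2:{ intros j; rewrite (Hf (root_of_unity d j)); reflexivity. }
    rewrite sum_n_mult_r sum_roots_of_unity; [|lia].
    symmetry; apply Cmult_assoc.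
  - destruct Hf as (g & h & Hg & Hh & E).
    rewrite (sum_n_ext _ (fun j => plus
      (Cmult (Cpow (root_of_unity d j) m) (g (root_of_unity d j)))
      (Cmult (Cpow (root_of_unity d j) (S m)) (h (root_of_unity d j))))).
    2:{ intros j; rewrite E Cpow_S; Cring. }
    rewrite sum_n_plus (IH m g) // ?(IH (S m) h) //; [|lia|lia].
    rewrite E Cpow_S; Cring.
Qed.

(** The value at the centre is an average of values on the unit circle. *)
Lemma maximum_principle n f M : poly_deg n f ->
  (forall t, Cmod t = 1 -> Cmod (f t) <= M) -> Cmod (f 0) <= M.
Proof.
  intros Hf HM.
  assert (HN := lt_0_INR (S n) (Nat.lt_0_succ n)).
  assert (E := mean_value n 0 n f (Nat.le_refl n) Hf); simpl Cpow in E.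
  assert (B : Cmod (Cmult (INR (S n)) (Cmult 1 (f 0))) <= INR (S n) * M).
  { rewrite <- E.
    eapply Rle_trans; [apply (norm_sum_n_m (V := C_NormedModule))|].
    rewrite <- (Nat.sub_0_r (S n)) at 1.
    rewrite <- (sum_n_m_const 0 n M).
    apply sum_n_m_le; intros j; change norm with Cmod.
    rewrite Cmult_1_l; apply HM, Cmod_cis. }
  rewrite Cmult_1_l Cmod_mult Cmod_R Rabs_pos_eq in B; [|lra].
  apply Rmult_le_reg_l in B; lra.
Qed.

(** * Polynomials and hulls along a complex line *)

(** The first [j] arguments move along the line and the others are arbitrary:
    linearity in the [j]-th argument is exactly one Horner step. *)
Lemma multilinear_along_line k (A : ('I_k -> c0) -> C) (x v : c0) :
  multilinear A ->
  forall j, (j <= k)%nat -> forall y : 'I_k -> c0,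
    poly_deg j (fun t => A (fun i =>
      if Nat.ltb (nat_of_ord i) j then plus (scal t v) x else y i)).
Proof.
  intros HA j; induction j as [|j IH]; intros Hj y.
  - intros t; reflexivity.
  - assert (Hjk : is_true (ssrnat.leq (S j) k)) by (apply/ssrnat.leP; lia).
    set (jj := Ordinal Hjk).
    exists (fun t => A (fun i => if Nat.ltb (nat_of_ord i) j
                         then plus (scal t v) x else update y jj x i)).
    exists (fun t => A (fun i => if Nat.ltb (nat_of_ord i) j
                         then plus (scal t v) x else update y jj v i)).
    split; [apply IH; lia|split; [apply IH; lia|]].
    intros t.
    set (w := fun i : 'I_k => if Nat.ltb (nat_of_ord i) j
                         then plus (scal t v) x else y i).
    assert (Hw : forall u, (fun i : 'I_k => if Nat.ltb (nat_of_ord i) j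
                         then plus (scal t v) x else update y jj u i)
                   = update w jj u).
    { intros u; apply functional_extensionality; intros i.
      unfold update, w; destruct (eqVneq i jj) as [->|Hi]; [|reflexivity].
      unfold jj; simpl; now rewrite Nat.ltb_irrefl. }
    rewrite !Hw Cplus_comm -HA; f_equal.
    apply functional_extensionality; intros i.
    unfold update, w; destruct (eqVneq i jj) as [->|Hi].
    + replace (Nat.ltb (nat_of_ord jj) (S j)) with true; [reflexivity|].
      symmetry; apply Nat.ltb_lt; simpl; lia.
    + assert (Hne : nat_of_ord i <> j).
      { intros E; move/negP: Hi; apply; apply/eqP; apply ord_inj; exact E. }
      replace (Nat.ltb (nat_of_ord i) (S j)) with (Nat.ltb (nat_of_ord i) j);
        [reflexivity|].
      destruct (Nat.ltb_spec (nat_of_ord i) j), (Nat.ltb_spec (nat_of_ord i) (S j));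
        try reflexivity; lia.
Qed.

Lemma polynomial_along_line P x v : polynomial P ->
  exists n, poly_deg n (fun t => P (plus (scal t v) x)).
Proof.
  intros (n & Q & HQ & HP).
  assert (Hk : forall k, exists m, poly_deg m (fun t => Q k (plus (scal t v) x))).
  { intros k; exists k; destruct (HQ k) as (A & HA & E).
    assert (H := multilinear_along_line k A x v HA k (Nat.le_refl k) (fun _ => x)).
    eapply eq_ind; [exact H|].
    f_equal; apply functional_extensionality; intros t; rewrite E; f_equal.
    apply functional_extensionality; intros i.
    replace (Nat.ltb (nat_of_ord i) k) with true; [reflexivity|].
    symmetry; apply Nat.ltb_lt; apply/ssrnat.ltP; apply ltn_ord. }
  assert (Hle : forall m m' f, (m <= m')%nat -> poly_deg m f -> poly_deg m' f).
  { intros m m' f Hm; induction Hm; auto using poly_deg_S. }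
  assert (Hsum : forall N, exists m,
    poly_deg m (fun t => sum_n (fun k => Q k (plus (scal t v) x)) N)).
  { induction N as [|N [m IH]].
    - destruct (Hk 0%nat) as [m Hm]; exists m.
      eapply eq_ind; [exact Hm|].
      f_equal; apply functional_extensionality; intros t; now rewrite sum_O.
    - destruct (Hk (S N)) as [m' Hm']; exists (Nat.max m m').
      eapply eq_ind; [apply (poly_deg_plus (Nat.max m m'));
        [eapply Hle; [|exact IH]|eapply Hle; [|exact Hm']]; lia|].
      f_equal; apply functional_extensionality; intros t; now rewrite sum_Sn. }
  destruct (Hsum n) as [m Hm]; exists m.
  eapply eq_ind; [exact Hm|].
  f_equal; apply functional_extensionality; intros t; now rewrite HP.
Qed.

(** The centre of an affine disc is in the hull of any set containing the boundary
    of the disc. *)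
Lemma disc_in_hull (A : c0 -> Prop) x v :
  (forall t, Cmod t = 1 -> A (plus (scal t v) x)) -> poly_hull A x.
Proof.
  intros HA P [HP _].
  destruct (polynomial_along_line P x v HP) as [n Hn].
  unfold sup_on.
  set (E := fun r => exists a, A a /\ r = Cmod (P a)).
  assert (Hub : forall t, Cmod t = 1 ->
            Rbar_le (Cmod (P (plus (scal t v) x))) (Lub_Rbar E)).
  { intros t Ht; apply (proj1 (Lub_Rbar_correct E)).
    exists (plus (scal t v) x); auto. }
  destruct (Lub_Rbar E) as [s| |]; simpl; auto.
  - assert (H := maximum_principle n _ s Hn Hub); simpl in H.
    replace (plus (scal (RtoC 0) v) x) with x in H; [exact H|].
    apply c0_ext; intros i; simpl; ring.
  - apply (Hub (RtoC 1)), Cmod_1.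
Qed.

(** * The domain *)

Definition even_part (x : c0) (n : nat) : C := x (2 * n)%nat.
Definition odd_part (x : c0) (n : nat) : C := x (2 * n + 1)%nat.

(** [x] satisfies the conditions defining the domain with margin [r].  Requiring
    the same margin for all [n] makes openness immediate and controls the
    distance to the complement. *)
Definition deep (r : R) (x : c0) : Prop := forall n,
  Cmod (even_part x n) + r <= 1 \/
  Rabs (Cmod (even_part x n) - Cmod (odd_part x n)) + r <= / INR (S n).

Definition thin_domain (x : c0) : Prop := exists r, 0 < r /\ deep r x.

Lemma Cmod_le_norm (x : c0) n : Cmod (x n) <= norm x.
Proof. apply c0_norm_ub. Qed.

Lemma Cmod_coord_lipschitz (x y : c0) n :
  Rabs (Cmod (y n) - Cmod (x n)) <= norm (minus y x).
Proof.
  eapply Rle_trans; [apply (norm_triangle_inv (V := C_NormedModule))|].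
  apply (Cmod_le_norm (minus y x) n).
Qed.

Lemma c0_norm_minus_sym (x y : c0) : norm (minus x y) = norm (minus y x).
Proof.
  rewrite <- (norm_opp (V := c0_NormedModule) (minus y x)).
  f_equal; apply c0_ext; intros i; simpl; ring.
Qed.

(** Both defining quantities are 2-Lipschitz, so that moving by [r / 4] costs at
    most [r / 2] of the margin. *)
Lemma deep_nearby r x y : deep r x -> norm (minus y x) <= r / 4 -> deep (r / 2) y.
Proof.
  intros Hx Hy n.
  assert (He := Cmod_coord_lipschitz x y (2 * n)%nat).
  assert (Ho := Cmod_coord_lipschitz x y (2 * n + 1)%nat).
  fold (even_part x n) (even_part y n) in He.
  fold (odd_part x n) (odd_part y n) in Ho.
  apply Rabs_le_between in He; apply Rabs_le_between in Ho.
  destruct (Hx n) as [H|H]; [left; lra|right].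
  assert (H' : Rabs (Cmod (even_part x n) - Cmod (odd_part x n)) <= / INR (S n) - r)
    by lra.
  apply Rabs_le_between in H'.
  assert (Rabs (Cmod (even_part y n) - Cmod (odd_part y n)) <= / INR (S n) - r / 2);
    [apply Rabs_le_between|]; lra.
Qed.

Lemma thin_domain_open : open thin_domain.
Proof.
  intros x (r & Hr & Hx).
  assert (H4 : 0 < r / 4) by lra.
  exists (mkposreal _ H4); intros y Hy.
  exists (r / 2); split; [lra|].
  apply (deep_nearby r x y Hx), Rlt_le; exact Hy.
Qed.

Lemma thin_domain_balanced : balanced thin_domain.
Proof.
  intros a x Ha (r & Hr & Hx); exists r; split; [exact Hr|]; intros n.
  assert (H0 := Cmod_ge_0 a).
  change (even_part (scal a x) n) with (Cmult a (even_part x n)).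
  change (odd_part (scal a x) n) with (Cmult a (odd_part x n)).
  rewrite !Cmod_mult.
  destruct (Hx n) as [H|H]; [left|right].
  - assert (Hz := Cmod_ge_0 (even_part x n)); nra.
  - rewrite <- Rmult_minus_distr_l, Rabs_mult, (Rabs_pos_eq _ H0).
    assert (Hz := Rabs_pos (Cmod (even_part x n) - Cmod (odd_part x n))); nra.
Qed.

(** * Distances and the fundamental sequence *)

Lemma set_dist_ge (A B : c0 -> Prop) (e : R) :
  (forall a b, A a -> B b -> e <= norm (minus a b)) -> Rbar_le e (set_dist A B).
Proof.
  intros H; apply (proj2 (Glb_Rbar_correct _)).
  intros r (a & b & Ha & Hb & ->); simpl; auto.
Qed.

Lemma set_dist_pos (A B : c0 -> Prop) : Rbar_lt 0 (set_dist A B) ->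
  exists e, 0 < e /\ forall a b, A a -> B b -> e <= norm (minus a b).
Proof.
  unfold set_dist; set (E := fun r => exists a b, A a /\ B b /\ r = norm (minus a b)).
  intros Hpos.
  assert (Hlb : forall a b, A a -> B b -> Rbar_le (Glb_Rbar E) (norm (minus a b))).
  { intros a b Ha Hb; apply (proj1 (Glb_Rbar_correct E)); exists a, b; auto. }
  destruct (Glb_Rbar E) as [e| |]; simpl in *; [exists e| |]; try easy.
  exists 1; split; [lra|]; intros a b Ha Hb; destruct (Hlb a b Ha Hb).
Qed.

Lemma deep_in_exhaustion r x n : deep r x ->
  / INR (S n) <= r / 4 -> norm x <= INR (S n) -> exhaustion thin_domain n x.
Proof.
  intros Hx Hn Hnx.
  assert (Hinv : 0 < / INR (S n)) by (apply Rinv_0_lt_compat, lt_0_INR; lia).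
  split; [exists r; split; [lra|exact Hx]|split; [|exact Hnx]].
  apply set_dist_ge; intros a b -> Hb.
  destruct (Rle_lt_dec (/ INR (S n)) (norm (minus x b))) as [H|H]; [exact H|].
  exfalso; apply Hb; exists (r / 2); split; [lra|].
  apply (deep_nearby r x b Hx).
  rewrite c0_norm_minus_sym; lra.
Qed.

(** * A ball of fixed radius in the hull *)

Definition basis (m : nat) : c0.
Proof.
  exists (fun i => if Nat.eqb i m then RtoC 1 else RtoC 0).
  apply (is_lim_seq_ext_loc (fun _ => 0)); [|apply is_lim_seq_const].
  exists (S m); intros i Hi.
  destruct (Nat.eqb_spec i m); [lia|now rewrite Cmod_0].
Defined.

Lemma basis_same m : basis m m = RtoC 1.
Proof. simpl; now rewrite Nat.eqb_refl. Qed.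

Lemma basis_other m i : i <> m -> basis m i = RtoC 0.
Proof. intros H; simpl; destruct (Nat.eqb_spec i m); [contradiction|reflexivity]. Qed.

Lemma norm_scal_basis a m : norm (scal a (basis m)) <= Cmod a.
Proof.
  apply c0_norm_lub; intros i.
  change (Cmod (Cmult a (basis m i)) <= Cmod a).
  destruct (Nat.eq_dec i m) as [->|H].
  - rewrite basis_same Cmult_1_r; lra.
  - rewrite basis_other // Cmult_0_r Cmod_0; apply Cmod_ge_0.
Qed.

Definition spike (n : nat) : c0 := scal (RtoC 2) (basis (2 * n)).

Lemma spike_even n m : even_part (spike n) m = if Nat.eqb m n then RtoC 2 else 0.
Proof.
  change (even_part (spike n) m) with (Cmult 2 (basis (2 * n) (2 * m)%nat)).
  destruct (Nat.eqb_spec m n) as [->|H].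
  - rewrite basis_same; ring.
  - rewrite basis_other; [ring|lia].
Qed.

(** On the unit circle, [1 + conj c t] is [t] times the conjugate of [t + c].  Thus,
    when [|c| < 1], [(t + c) / (1 + conj c t)] is unimodular there and equal to [c] at [t = 0], and
    clearing its denominator gives a disc that is affine in [t]. *)
Lemma Cmod_disc_boundary (c t : C) : Cmod t = 1 ->
  Cmod (Cplus 1 (Cmult (Cconj c) t)) = Cmod (Cplus t c).
Proof.
  intros Ht.
  assert (E : Cmult t (Cconj t) = RtoC 1).
  { rewrite <- Cmod2_conj, Ht; f_equal; ring. }
  replace (Cplus 1 (Cmult (Cconj c) t)) with (Cmult t (Cconj (Cplus t c))).
  - rewrite Cmod_mult Ht Cmod_conj; ring.
  - rewrite Cplus_conj Cmult_plus_distr_l E; ring.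
Qed.

(** The ratio [w / z] of the [n]-th pair moves to unimodular values at the boundary
    of the disc, where the margin of the domain is [1/(2(n+1))]: this depends on
    [n], but it suffices that each [x] is in the hull of one member of the
    fundamental sequence. *)
Lemma ball_spike_in_hull n (x : c0) : norm (minus x (spike n)) < 1 / 2 ->
  open_hull thin_domain x.
Proof.
  intros Hx.
  set (z := even_part x n); set (w := odd_part x n).
  assert (Hc : forall i, Cmod (Cminus (x i) (spike n i)) < 1 / 2).
  { intros i; eapply Rle_lt_trans; [|exact Hx].
    apply (Cmod_le_norm (minus x (spike n)) i). }
  assert (Hz : z <> RtoC 0).
  { intros E; specialize (Hc (2 * n)%nat).
    change (Cmod (Cminus z (even_part (spike n) n)) < 1 / 2) in Hc.
    rewrite spike_even Nat.eqb_refl E in Hc.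
    replace (Cminus 0 2) with (RtoC (-2)) in Hc
      by (rewrite <- RtoC_minus; f_equal; ring).
    rewrite Cmod_R Rabs_left in Hc; lra. }
  assert (Hev : forall m, m <> n -> Cmod (even_part x m) < 1 / 2).
  { intros m Hm; specialize (Hc (2 * m)%nat).
    change (Cmod (Cminus (even_part x m) (even_part (spike n) m)) < 1 / 2) in Hc.
    rewrite spike_even in Hc; destruct (Nat.eqb_spec m n); [contradiction|].
    replace (even_part x m) with (Cminus (even_part x m) 0) by ring; exact Hc. }
  set (c := Cdiv w z).
  set (v := plus (scal (Cmult z (Cconj c)) (basis (2 * n)))
                 (scal z (basis (2 * n + 1)))).
  assert (Hphi_e : forall t m, even_part (plus (scal t v) x) m
     = if Nat.eqb m n then Cmult z (Cplus 1 (Cmult (Cconj c) t)) else even_part x m).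
  { intros t m.
    change (even_part (plus (scal t v) x) m) with
      (Cplus (Cmult t (Cplus (Cmult (Cmult z (Cconj c)) (basis (2 * n) (2 * m)%nat))
                             (Cmult z (basis (2 * n + 1) (2 * m)%nat))))
             (even_part x m)).
    rewrite (basis_other (2 * n + 1)); [|lia].
    destruct (Nat.eqb_spec m n) as [->|H].
    - rewrite basis_same; fold z; ring.
    - rewrite basis_other; [ring|lia]. }
  assert (Hphi_o : forall t, odd_part (plus (scal t v) x) n = Cmult z (Cplus t c)).
  { intros t.
    change (odd_part (plus (scal t v) x) n) with
      (Cplus (Cmult t (Cplus (Cmult (Cmult z (Cconj c)) (basis (2 * n) (2 * n + 1)%nat))
                             (Cmult z (basis (2 * n + 1) (2 * n + 1)%nat))))
             w).
    rewrite basis_other; [|lia]; rewrite basis_same; unfold c; field; exact Hz. }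
  assert (Hdeep : forall t, Cmod t = 1 ->
            deep (/ (2 * INR (S n))) (plus (scal t v) x)).
  { intros t Ht m.
    assert (Hn : 1 <= INR (S n)) by (rewrite S_INR; generalize (pos_INR n); lra).
    assert (Hi : / INR (S n) <= 1) by (rewrite <- Rinv_1; apply Rinv_le_contravar; lra).
    assert (Hi' : 0 < / INR (S n)) by (apply Rinv_0_lt_compat; lra).
    rewrite Rinv_mult Hphi_e; destruct (Nat.eqb_spec m n) as [->|Hm].
    - right; rewrite Hphi_o !Cmod_mult Cmod_disc_boundary //.
      rewrite Rminus_diag Rabs_R0; lra.
    - left; specialize (Hev m Hm); lra. }
  (* [k + 1] must exceed both the inverse of a quarter of the margin and the norms
     of the points of the disc. *)
  destruct (nfloor_ex (8 * INR (S n) + norm v + norm x)) as [k Hk].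
  { assert (H1 := norm_ge_0 v); assert (H2 := norm_ge_0 x).
    assert (H3 := pos_INR (S n)); lra. }
  exists k; apply (disc_in_hull _ x v); intros t Ht.
  assert (Hn := lt_0_INR (S n) (Nat.lt_0_succ n)).
  assert (H1 := norm_ge_0 v); assert (H2 := norm_ge_0 x).
  apply (deep_in_exhaustion _ _ _ (Hdeep t Ht)).
  - replace (/ (2 * INR (S n)) / 4) with (/ (8 * INR (S n))) by (field; lra).
    apply Rinv_le_contravar; rewrite ?(S_INR k); lra.
  - eapply Rle_trans; [apply c0_norm_triangle|].
    assert (H3 := c0_norm_scal t v); rewrite Ht in H3; rewrite (S_INR k).
    change (c0_norm (scal t v) + norm x <= INR k + 1).
    change (c0_norm (scal t v) <= 1 * norm v) in H3; lra.
Qed.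

Lemma spikes_bounded_in_hull :
  bounded_in (open_hull thin_domain) (fun x => exists n, x = spike n).
Proof.
  split; [|split].
  - intros x [n ->]; apply (ball_spike_in_hull n).
    rewrite minus_eq_zero norm_zero; lra.
  - exists 2; intros x [n ->]; eapply Rle_trans; [apply norm_scal_basis|].
    rewrite Cmod_R Rabs_pos_eq; lra.
  - apply Rbar_lt_le_trans with (1 / 2); [simpl; lra|].
    apply set_dist_ge; intros a b [n ->] Hb.
    destruct (Rle_lt_dec (1 / 2) (norm (minus (spike n) b))) as [H|H]; [exact H|].
    exfalso; apply Hb, (ball_spike_in_hull n).
    rewrite c0_norm_minus_sym; exact H.
Qed.

(** * Points far from the complement avoid the thin shells *)

(** Covers [z = 0], where any unimodular [u] increases the modulus. *)
Lemma exists_direction (z : C) : exists u, Cmod u = 1 /\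
  forall s, 0 <= s -> Cmod (Cplus z (Cmult s u)) = Cmod z + s.
Proof.
  destruct (Ceq_dec z 0) as [->|Hz].
  - exists (RtoC 1); split; [apply Cmod_1|intros s Hs].
    rewrite Cplus_0_l Cmult_1_r Cmod_0 Cmod_R Rabs_pos_eq; lra.
  - assert (H := proj1 (Cmod_gt_0 z) Hz).
    assert (HC : RtoC (Cmod z) <> RtoC 0) by (intros E; apply RtoC_inj in E; lra).
    exists (Cdiv z (Cmod z)); split.
    + rewrite Cmod_div // Cmod_R Rabs_pos_eq; [|lra].
      field; lra.
    + intros s Hs.
      replace (Cplus z (Cmult s (Cdiv z (Cmod z))))
        with (Cmult (RtoC (1 + s / Cmod z)) z).
      * rewrite Cmod_mult Cmod_R Rabs_pos_eq; [field; lra|].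
        assert (0 <= s / Cmod z) by (apply Rdiv_le_0_compat; lra); lra.
      * rewrite RtoC_plus RtoC_div; [field; exact HC|lra].
Qed.

(** Moving [z_n] alone by [s u] leaves the domain as soon as both alternatives of
    its [n]-th condition fail. *)
Lemma escape x n s u : Cmod u = 1 -> 0 <= s ->
  Cmod (Cplus (even_part x n) (Cmult s u)) = Cmod (even_part x n) + s ->
  1 <= Cmod (even_part x n) + s ->
  / INR (S n) <= Rabs (Cmod (even_part x n) + s - Cmod (odd_part x n)) ->
  exists y, ~ thin_domain y /\ norm (minus x y) <= s.
Proof.
  intros Hu Hs Hus H1 H2.
  exists (plus x (scal (Cmult s u) (basis (2 * n)))); split.
  - intros (r & Hr & Hy); specialize (Hy n).
    set (y := plus _ _) in Hy.
    assert (He : even_part y n = Cplus (even_part x n) (Cmult s u)).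
    { change (even_part y n) with
        (Cplus (even_part x n) (Cmult (Cmult s u) (basis (2 * n) (2 * n)%nat))).
      rewrite basis_same; ring. }
    assert (Ho : odd_part y n = odd_part x n).
    { change (odd_part y n) with
        (Cplus (odd_part x n) (Cmult (Cmult s u) (basis (2 * n) (2 * n + 1)%nat))).
      rewrite basis_other; [ring|lia]. }
    rewrite He Ho Hus in Hy; lra.
  - rewrite c0_norm_minus_sym.
    replace (minus _ x) with (scal (Cmult s u) (basis (2 * n))).
    + eapply Rle_trans; [apply norm_scal_basis|].
      rewrite Cmod_mult Hu Cmod_R Rabs_pos_eq //; lra.
    + apply c0_ext; intros i; simpl; ring.
Qed.

(** If [|z_n| > 1 - e/2], adding [e/2] or [3e/4] to [|z_n|] brings it above [1], at
    a cost less than [e].  The two new values of [|z_n| - |w_n|] differ by [e/4],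
    which exceeds the width [2/(n+1)] of the shell, so one of them leaves the
    domain. *)
Lemma even_part_small e x n : 0 < e ->
  (forall y, ~ thin_domain y -> e <= norm (minus x y)) ->
  8 < e * INR (S n) -> Cmod (even_part x n) <= 1 - e / 2.
Proof.
  intros He Hx Hn; apply Rnot_lt_le; intros Hlt.
  destruct (exists_direction (even_part x n)) as (u & Hu & Hs).
  assert (HN := lt_0_INR (S n) (Nat.lt_0_succ n)).
  assert (Hi : / INR (S n) < e / 8).
  { apply Rmult_lt_reg_r with (INR (S n)); [exact HN|].
    rewrite Rinv_l; lra. }
  set (D := Cmod (even_part x n) - Cmod (odd_part x n)).
  assert (Hone : forall s, e / 2 <= s < e -> Rabs (D + s) < / INR (S n)).
  { intros s Hse; apply Rnot_le_lt; intros Hge.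
    destruct (escape x n s u) as (y & Hy & Hxy); auto; try lra.
    - apply Hs; lra.
    - replace (_ + s - _) with (D + s) by (unfold D; ring); exact Hge.
    - specialize (Hx y Hy); lra. }
  assert (Ha := Hone (e / 2)); assert (Hb := Hone (3 * e / 4)).
  specialize (Ha ltac:(lra)); specialize (Hb ltac:(lra)).
  apply Rabs_def2 in Ha; apply Rabs_def2 in Hb; lra.
Qed.

(** * Sums of complex series *)

Definition csum (a : nat -> C) : C :=
  iota (T := C_CompleteNormedModule) (is_series (V := C_NormedModule) a).

Lemma is_series_C_unique (a : nat -> C) s s' :
  is_series (V := C_NormedModule) a s -> is_series (V := C_NormedModule) a s' -> s = s'.
Proof.
  apply (filterlim_locally_unique (V := C_NormedModule)).
Qed.

Lemma csum_unique (a : nat -> C) s : is_series (V := C_NormedModule) a s -> csum a = s.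
Proof.
  intros H; apply (is_series_C_unique a); [|exact H].
  refine (iota_correct (V := C_CompleteNormedModule)
    (is_series (V := C_NormedModule) a) _).
  exists s; split; [exact H|]; intros s' H'; exact (is_series_C_unique a s s' H H').
Qed.

Lemma csum_correct (a : nat -> C) (b : nat -> R) : ex_series b ->
  (forall n, Cmod (a n) <= b n) -> is_series (V := C_NormedModule) a (csum a).
Proof.
  intros Hb Hab.
  destruct (ex_series_le (V := C_CompleteNormedModule) a b Hab Hb) as [s Hs].
  rewrite (csum_unique a s Hs); exact Hs.
Qed.

Lemma series_norm_le (a : nat -> C) (b : nat -> R) s B :
  is_series (V := C_NormedModule) a s -> is_series b B ->
  (forall n, Cmod (a n) <= b n) -> Cmod s <= B.
Proof.
  intros Ha Hb Hab.
  apply (is_lim_seq_le (fun n => Cmod (sum_n a n)) (sum_n b) (Cmod s) B).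
  - intros n; eapply Rle_trans; [apply (norm_sum_n_m (V := C_NormedModule))|].
    apply sum_n_m_le; exact Hab.
  - exact (filterlim_comp _ _ _ _ _ _ _ _ Ha (filterlim_norm (V := C_NormedModule) s)).
  - exact Hb.
Qed.

(** * Taylor estimates for powers *)

(** The derivative [n z^(n-1)], by the product rule. *)
Fixpoint dpow (z : C) (n : nat) : C :=
  match n with
  | O => 0
  | S n => Cplus (Cmult z (dpow z n)) (Cpow z n)
  end.

Lemma Cpow_le (z : C) r n : 0 <= r -> Cmod (Cpow z n) <= (Cmod z + r) ^ n.
Proof.
  intros Hr.
  rewrite Cmod_pow; apply pow_incr; assert (H := Cmod_ge_0 z); lra.
Qed.

Lemma dpow_le (z : C) r n : 0 <= r -> r * Cmod (dpow z n) <= (Cmod z + r) ^ n.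
Proof.
  intros Hr.
  assert (Hz := Cmod_ge_0 z).
  induction n as [|n IH]; simpl dpow.
  - rewrite Cmod_0; simpl; lra.
  - assert (H1 := Cmod_triangle (Cmult z (dpow z n)) (Cpow z n)).
    assert (H2 := Cpow_le z r n Hr); rewrite Cmod_mult in H1; simpl pow.
    assert (H3 := Rmult_le_compat_l _ _ _ Hz IH).
    assert (H4 := Rmult_le_compat_l _ _ _ Hr H1).
    assert (H5 := Rmult_le_compat_l _ _ _ Hr H2); lra.
Qed.

Lemma Cpow_increment_le (z h : C) r n : 0 <= r -> Cmod h <= r ->
  r * Cmod (Cminus (Cpow (Cplus z h) n) (Cpow z n)) <= Cmod h * (Cmod z + r) ^ n.
Proof.
  intros Hr Hh.
  assert (Hz := Cmod_ge_0 z); assert (Hh0 := Cmod_ge_0 h).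
  induction n as [|n IH].
  - simpl Cpow; replace (Cminus 1 1) with (RtoC 0) by ring.
    rewrite Cmod_0; simpl; lra.
  - replace (Cminus (Cpow (Cplus z h) (S n)) (Cpow z (S n))) with
      (Cplus (Cmult z (Cminus (Cpow (Cplus z h) n) (Cpow z n)))
             (Cmult h (Cpow (Cplus z h) n))) by (rewrite !Cpow_S; ring).
    eapply Rle_trans; [apply Rmult_le_compat_l; [exact Hr|apply Cmod_triangle]|].
    rewrite !Cmod_mult; simpl pow.
    assert (H2 : Cmod (Cpow (Cplus z h) n) <= (Cmod z + r) ^ n).
    { rewrite Cmod_pow; apply pow_incr; split; [apply Cmod_ge_0|].
      eapply Rle_trans; [apply Cmod_triangle|]; lra. }
    assert (H3 := Rmult_le_compat_l _ _ _ Hz IH).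
    assert (H4 := Rmult_le_compat_l _ _ _ (Rmult_le_pos _ _ Hr Hh0) H2); lra.
Qed.

(** All terms of the binomial expansion of order at least two in [h] carry the
    factor [(|h|/r)^2] when [|h| <= r], and the remaining factors add up to at most
    [(|z| + r)^n].  This form avoids factors depending on [n]. *)
Lemma Cpow_taylor_le (z h : C) r n : 0 <= r -> Cmod h <= r ->
  r ^ 2 * Cmod (Cminus (Cminus (Cpow (Cplus z h) n) (Cpow z n)) (Cmult (dpow z n) h))
  <= Cmod h ^ 2 * (Cmod z + r) ^ n.
Proof.
  intros Hr Hh.
  assert (Hz := Cmod_ge_0 z); assert (Hh0 := Cmod_ge_0 h).
  induction n as [|n IH].
  - simpl Cpow; simpl dpow.
    replace (Cminus (Cminus 1 1) (Cmult 0 h)) with (RtoC 0) by ring.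
    rewrite Cmod_0; simpl; nra.
  - replace (Cminus (Cminus _ _) _) with
      (Cplus (Cmult z (Cminus (Cminus (Cpow (Cplus z h) n) (Cpow z n))
                              (Cmult (dpow z n) h)))
             (Cmult h (Cminus (Cpow (Cplus z h) n) (Cpow z n))))
      by (simpl dpow; rewrite !Cpow_S; ring).
    eapply Rle_trans;
      [apply Rmult_le_compat_l; [apply pow2_ge_0|apply Cmod_triangle]|].
    rewrite !Cmod_mult; simpl pow in *.
    assert (H3 := Rmult_le_compat_l _ _ _ Hz IH).
    assert (H4 := Rmult_le_compat_l _ _ _ (Rmult_le_pos _ _ Hr Hh0)
                    (Cpow_increment_le z h r n Hr Hh)); lra.
Qed.

(** * The entire function *)

(** The constant depends on [M], [q] and [N] only, hence the bound is uniform over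
    a set of sequences: the finitely many indices below [N] are absorbed by the
    factor [(M'/q)^N], where [M' = max(M, 1)]. *)
Lemma power_majorant (M q : R) (N : nat) : 0 < q <= 1 ->
  exists K, 0 <= K /\ forall u : nat -> R,
    (forall n, 0 <= u n <= M) -> (forall n, (N <= n)%nat -> u n <= q) ->
    forall n, u n ^ S n <= K * q ^ n.
Proof.
  intros Hq.
  set (M' := Rmax M 1).
  assert (HM1 : 1 <= M') by apply Rmax_r.
  assert (HMq : 1 <= M' / q) by (apply Rle_div_r; lra).
  exists (M' * (M' / q) ^ N); split.
  { apply Rmult_le_pos; [lra|apply pow_le; lra]. }
  intros u Hu Huq n.
  assert (HM : u n <= M') by (eapply Rle_trans; [apply Hu|apply Rmax_l]).
  assert (Hu0 := proj1 (Hu n)).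
  rewrite Rmult_assoc; simpl pow.
  apply Rmult_le_compat; auto; [apply pow_le; exact Hu0|].
  destruct (Nat.le_gt_cases N n) as [Hn|Hn].
  - apply Rle_trans with (q ^ n); [apply pow_incr; auto|].
    assert (H1 := pow_R1_Rle _ N HMq); assert (H2 := pow_le q n ltac:(lra)); nra.
  - apply Rle_trans with (M' ^ n); [apply pow_incr; auto|].
    assert (H1 := Rle_pow (M' / q) n N HMq ltac:(lia)).
    assert (H2 := pow_le q n ltac:(lra)).
    apply Rmult_le_compat_r with (r := q ^ n) in H1; [|exact H2].
    rewrite <- Rpow_mult_distr in H1.
    replace (M' / q * q) with M' in H1 by (field; lra); exact H1.
Qed.

Lemma series_geom_scal K q : 0 < q < 1 -> is_series (fun n => K * q ^ n) (K * / (1 - q)).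
Proof.
  intros Hq; apply (is_series_scal (V := R_NormedModule) K (fun n => q ^ n)), is_series_geom.
  rewrite Rabs_pos_eq; lra.
Qed.

Definition diagonal_series (x : c0) : C := csum (fun n => Cpow (even_part x n) (S n)).

Lemma even_part_null (x : c0) e : 0 < e ->
  exists N, forall n, (N <= n)%nat -> Cmod (even_part x n) <= e.
Proof.
  intros He.
  destruct (proj2 (is_lim_seq_spec _ 0) (coord_null x) (mkposreal _ He)) as [N HN].
  exists N; intros n Hn; specialize (HN (2 * n)%nat ltac:(lia)); simpl in HN.
  rewrite Rminus_0_r Rabs_pos_eq in HN; [|apply Cmod_ge_0].
  apply Rlt_le; exact HN.
Qed.

Lemma shifted_majorant (x : c0) : exists K, 0 <= K /\
  forall n, (Cmod (even_part x n) + 1 / 4) ^ S n <= K * (1 / 2) ^ n.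
Proof.
  destruct (even_part_null x (1 / 4)) as [N HN]; [lra|].
  destruct (power_majorant (norm x + 1 / 4) (1 / 2) N) as (K & HK & H); [lra|].
  exists K; split; [exact HK|].
  apply (H (fun n => Cmod (even_part x n) + 1 / 4)).
  - intros n; assert (H0 := Cmod_ge_0 (even_part x n)).
    assert (H1 := Cmod_le_norm x (2 * n)%nat : Cmod (even_part x n) <= norm x); lra.
  - intros n Hn; specialize (HN n Hn); lra.
Qed.

Lemma diagonal_series_converges (x : c0) :
  is_series (V := C_NormedModule) (fun n => Cpow (even_part x n) (S n)) (diagonal_series x).
Proof.
  destruct (shifted_majorant x) as (K & HK & H).
  apply csum_correct with (fun n => K * (1 / 2) ^ n).
  - eexists; apply series_geom_scal; lra.
  - intros n; eapply Rle_trans; [apply (Cpow_le _ (1 / 4)); lra|apply H].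
Qed.

(** Differentiation term by term: near [x], the terms of the differential and of
    the Taylor remainder are dominated by the convergent series of
    [shifted_majorant], with the radius [r = 1/4]. *)
Lemma diagonal_series_entire W : holomorphic_on W diagonal_series.
Proof.
  intros x _.
  destruct (shifted_majorant x) as (K & HK & HX).
  set (z := even_part x) in *.
  set (l := fun h : c0 => csum (fun n => Cmult (dpow (z n) (S n)) (even_part h n))).
  assert (Hterm : forall (h : c0) n,
    Cmod (Cmult (dpow (z n) (S n)) (even_part h n)) <= 4 * K * norm h * (1 / 2) ^ n).
  { intros h n; rewrite Cmod_mult.
    assert (H1 := dpow_le (z n) (1 / 4) (S n) ltac:(lra)).
    assert (H2 := Cmod_le_norm h (2 * n)%nat : Cmod (even_part h n) <= norm h).
    specialize (HX n).
    replace (4 * K * norm h * (1 / 2) ^ n) with ((4 * (K * (1 / 2) ^ n)) * norm h) by ring.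
    apply Rmult_le_compat; try apply Cmod_ge_0; [lra|exact H2]. }
  assert (Hl : forall h : c0, is_series (V := C_NormedModule)
    (fun n => Cmult (dpow (z n) (S n)) (even_part h n)) (l h)).
  { intros h; eapply csum_correct; [|apply Hterm].
    eexists; apply series_geom_scal; lra. }
  exists l; split; [split|].
  - intros h k; apply csum_unique.
    apply (is_series_ext (V := C_NormedModule)
      (fun n => plus (Cmult (dpow (z n) (S n)) (even_part h n))
                     (Cmult (dpow (z n) (S n)) (even_part k n)))).
    + intros n; symmetry; apply Cmult_plus_distr_l.
    + apply (is_series_plus (V := C_NormedModule)); apply Hl.
  - intros a h; apply csum_unique.
    apply (is_series_ext (V := C_NormedModule)
      (fun n => scal a (Cmult (dpow (z n) (S n)) (even_part h n)))).
    + intros n; change (Cmult a (Cmult (dpow (z n) (S n)) (even_part h n))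
        = Cmult (dpow (z n) (S n)) (Cmult a (even_part h n))); ring.
    + apply (is_series_scal (V := C_NormedModule)); apply Hl.
  - exists (8 * K + 1); split; [lra|]; intros h.
    assert (Hn := c0_norm_ge_0 h : 0 <= norm h).
    assert (H : Cmod (l h) <= 4 * K * norm h * / (1 - 1 / 2)).
    { eapply series_norm_le; [apply Hl|apply series_geom_scal; lra|apply Hterm]. }
    replace (/ (1 - 1 / 2)) with 2 in H by field.
    change (Cmod (l h) <= (8 * K + 1) * norm h); lra.
  - intros x' Hx'; apply (is_filter_lim_locally_unique x x') in Hx'; subst x'.
    intros eps.
    assert (He := cond_pos eps).
    assert (Hd : 0 < Rmin (1 / 4) (eps / (32 * K + 1))).
    { apply Rmin_pos; [lra|apply Rdiv_lt_0_compat; lra]. }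
    exists (mkposreal _ Hd); intros y Hy.
    change (norm (minus y x) < Rmin (1 / 4) (eps / (32 * K + 1))) in Hy.
    set (h := minus y x) in *.
    assert (Hh := c0_norm_ge_0 h : 0 <= norm h).
    assert (H4 := Rlt_le_trans _ _ _ Hy (Rmin_l _ _)).
    assert (He' := Rlt_le_trans _ _ _ Hy (Rmin_r _ _)).
    assert (Hsum : Cmod (Cminus (Cminus (diagonal_series y) (diagonal_series x)) (l h))
        <= 16 * K * norm h ^ 2 * / (1 - 1 / 2)).
    { eapply series_norm_le; [|apply series_geom_scal; lra|].
      - apply (is_series_minus (V := C_NormedModule)); [|apply Hl].
        apply (is_series_minus (V := C_NormedModule)); apply diagonal_series_converges.
      - intros n.
        assert (Hhn := Cmod_le_norm h (2 * n)%nat : Cmod (even_part h n) <= norm h).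
        assert (Hh0 := Cmod_ge_0 (even_part h n)).
        assert (T := Cpow_taylor_le (z n) (even_part h n) (1 / 4) (S n)
                       ltac:(lra) ltac:(lra)).
        replace (Cplus (z n) (even_part h n)) with (even_part y n) in T
          by (unfold h, z, even_part; simpl; ring).
        specialize (HX n).
        assert (Hsq : Cmod (even_part h n) ^ 2 <= norm h ^ 2) by (apply pow_incr; lra).
        assert (HP := Rmult_le_compat _ _ _ _ (pow2_ge_0 (Cmod (even_part h n)))
          (pow_le (Cmod (z n) + 1 / 4) (S n)
             ltac:(assert (H0 := Cmod_ge_0 (z n)); lra)) Hsq HX).
        match type of T with _ * ?c <= _ => change (c <= 16 * K * norm h ^ 2 * (1 / 2) ^ n) end.
        lra. }
    replace (/ (1 - 1 / 2)) with 2 in Hsum by field.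
    change (Cmod (Cminus (Cminus (diagonal_series y) (diagonal_series x)) (l h)) <= eps * norm h).
    eapply Rle_trans; [exact Hsum|].
    apply Rlt_div_r in He'; [|lra]; nra.
Qed.

Lemma diagonal_series_bounded_type : bounded_type thin_domain diagonal_series.
Proof.
  intros A (HA & [M HM] & Hd).
  destruct (set_dist_pos _ _ Hd) as (e0 & He0 & Hdist).
  (* Capping [e] keeps the ratio [1 - e/2] of the majorant positive. *)
  set (e := Rmin e0 1).
  assert (He : 0 < e) by (apply Rmin_pos; lra).
  assert (He1 : e <= 1) by apply Rmin_r.
  assert (Hee : e <= e0) by apply Rmin_l.
  destruct (nfloor_ex (8 / e)) as [N HN].
  { apply Rlt_le, Rdiv_lt_0_compat; lra. }
  destruct (power_majorant M (1 - e / 2) N) as (K & HK & H); [lra|].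
  exists (K * / (1 - (1 - e / 2))); intros x Hx.
  eapply series_norm_le;
    [apply diagonal_series_converges|apply (series_geom_scal K (1 - e / 2)); lra|].
  intros n; rewrite Cmod_pow; revert n.
  apply (H (fun n => Cmod (even_part x n))).
  - intros n; split; [apply Cmod_ge_0|].
    eapply Rle_trans; [apply (Cmod_le_norm x)|apply HM, Hx].
  - intros n Hn; apply even_part_small; auto.
    + intros y Hy; specialize (Hdist x y Hx Hy); lra.
    + rewrite Rmult_comm; apply Rlt_div_l; [exact He|].
      rewrite S_INR; apply le_INR in Hn; lra.
Qed.

Lemma diagonal_series_spike n : diagonal_series (spike n) = RtoC (2 ^ S n).
Proof.
  apply csum_unique.
  apply (filterlim_ext_loc (fun _ => RtoC (2 ^ S n))); [|apply filterlim_const].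
  exists n; intros k Hk.
  assert (Hlt : forall j, (j < n)%nat ->
    sum_n (fun i => Cpow (even_part (spike n) i) (S i)) j = RtoC 0).
  { induction j as [|j IH]; intros Hj; rewrite ?sum_O ?sum_Sn ?IH; try lia;
    rewrite spike_even;
    match goal with |- context [Nat.eqb ?a ?b] => destruct (Nat.eqb_spec a b) end;
    try lia; rewrite Cpow_S; Cring. }
  induction Hk as [|k Hk IH].
  - assert (Hn : Cpow (even_part (spike n) n) (S n) = RtoC (2 ^ S n)).
    { rewrite spike_even Nat.eqb_refl RtoC_pow; reflexivity. }
    destruct n as [|n]; [rewrite sum_O; symmetry; exact Hn|].
    rewrite sum_Sn Hlt; [|lia]; rewrite Hn; Cring.
  - rewrite sum_Sn -IH spike_even.
    destruct (Nat.eqb_spec (S k) n); [lia|]; rewrite Cpow_S; Cring.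
Qed.

Lemma diagonal_series_unbounded_on_spikes : ~ bounded_type (open_hull thin_domain) diagonal_series.
Proof.
  intros H; destruct (H _ spikes_bounded_in_hull) as [M HM].
  destruct (Pow_x_infinity 2 ltac:(rewrite Rabs_pos_eq; lra) (M + 1)) as [N HN].
  specialize (HM (spike N) (ex_intro _ N Logic.eq_refl)).
  specialize (HN (S N) ltac:(lia)).
  rewrite diagonal_series_spike Cmod_R in HM; lra.
Qed.

Theorem mainTheorem4 :
  exists (U : c0 -> Prop) (g : c0 -> C),
    open U /\ balanced U /\ Hb U g /\
    exists G : c0 -> C,
      holomorphic_on (open_hull U) G /\
      (forall x, U x -> G x = g x) /\
      ~ bounded_type (open_hull U) G.
Proof.
  exists thin_domain, diagonal_series.
  split; [exact thin_domain_open|split; [exact thin_domain_balanced|split]].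
  - split; [apply diagonal_series_entire|exact diagonal_series_bounded_type].
  - exists diagonal_series; split; [apply diagonal_series_entire|split; [reflexivity|]].
    exact diagonal_series_unbounded_on_spikes.
Qed.
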